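(* Let $n>l\ge 2$ be integers, let $j\in\{1,\dots,n\}$, and let $k>1$ be an odd natural number. If $n\ge (l-1)k$, then there exists a partition $\{\mathcal{S}_1,\dots,\mathcal{S}_k\}$ of $\mathsf{Vnodes}(G'(n,l,j))$ into $k$ sets such that, taking $\mathbf{V}:=\{\mathcal{S}_1,\dots,\mathcal{S}_k\}$, every element $\mathbf{X}$ of $2^{\mathbf{V}}\setminus\{\mathbf{V}\}$ (identified with the set of visible nodes $\bigcup_{\mathcal{S}_i\in\mathbf{X}}\mathcal{S}_i$) is injectable or expressible in $G'(n,l,j)$.
   Context: All superscript indices (including in ranges of index values) that are greater than $n$ or at most $0$ are taken modulo $n$ with representatives in $\{1,\dots,n\}$. The network $G(n,l)$ is the directed acyclic graph with visible nodes $A^{[1]},\dots,A^{[n]}$, latent nodes $L^{[1]},\dots,L^{[n]}$, and edges $L^{[i]}\to A^{[i]},A^{[i+1]},\dots,A^{[i+l-1]}$ for every $i\in\{1,\dots,n\}$ (and no other edges). The Cut inflation $G'(n,l,j)$ is the directed acyclic graph with visible nodes $\mathsf{Vnodes}(G'(n,l,j))=\{A_1^{[1]},\dots,A_1^{[n]}\}$ and latent nodes $L_1^{[1]},\dots,L_1^{[n]},L_2^{[j-l+2]},L_2^{[j-l+3]},\dots,L_2^{[j]}$, with exactly the following edges: if $i\notin\{j-l+2,\dots,j\}$ then $L_1^{[i]}$ is a parent of $A_1^{[i]},A_1^{[i+1]},\dots,A_1^{[i+l-1]}$; if $i\in\{j-l+2,\dots,j\}$ then $L_1^{[i]}$ is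 a parent of $A_1^{[i]},A_1^{[i+1]},\dots,A_1^{[j]}$ and $L_2^{[i]}$ is a parent of $A_1^{[j+1]},A_1^{[j+2]},\dots,A_1^{[i+l-1]}$. Dropping the copy index (the subscript) defines a map from nodes of $G'=G'(n,l,j)$ to nodes of $G=G(n,l)$. For a set $\bm{U}$ of nodes of a directed acyclic graph, the ancestral subgraph of $\bm{U}$ is the induced subgraph on $\bm{U}$ together with all ancestors of its elements. A set $\bm{U}'$ of visible nodes of $G'$ is injectable if there is a set $\bm{U}$ of visible nodes of $G$ such that dropping copy indices restricts to a bijection from $\bm{U}'$ to $\bm{U}$ and to a bijection from the nodes of the ancestral subgraph of $\bm{U}'$ in $G'$ to those of the ancestral subgraph of $\bm{U}$ in $G$ which is a graph isomorphism (an edge is present in the former iff the corresponding edge is present in the latter). A set of visible nodes of $G'$ is expressible if it is a union of injectable sets whose ancestral subgraphs in $G'$ are pairwise disjoint. The empty set counts as (trivially) injectable. *)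

(* Defs.v *)
From HB Require Import structures.
From mathcomp Require Import all_boot.

Set Implicit Arguments.
Unset Strict Implicit.
Unset Printing Implicit Defensive.

Record network := Network {
  node :> finType;
  edge : rel node;
  visible : {set node}
}.

(* The ancestral subgraph of U is the subgraph induced on this set; as
   [connect] is reflexive, U itself is included. *)
Definition ancestral (G : network) (U : {set G}) : {set G} :=
  [set x | [exists u in U, connect (@edge G) x u]].

Definition restricts_to_bijection (aT rT : finType) (f : aT -> rT)
    (A : {set aT}) (B : {set rT}) : Prop :=
  {in A &, injective f} /\ f @: A = B.

(* [drop] is the map G' -> G forgetting the copy index. *)
Definition injectable (G G' : network) (drop : G' -> G) (U' : {set G'}) : Prop :=
  U' \subset visible G' /\
  exists U : {set G},
    [/\ U \subset visible G,
        restricts_to_bijection drop U' U,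
        restricts_to_bijection drop (ancestral U') (ancestral U) &
        {in ancestral U' &, forall x y, edge (drop x) (drop y) = edge x y}].

Definition expressible (G G' : network) (drop : G' -> G) (U' : {set G'}) : Prop :=
  exists F : {set {set G'}},
    [/\ forall B, B \in F -> injectable drop B,
        {in F &, forall B C, B != C -> [disjoint ancestral B & ancestral C]} &
        cover F = U'].

(* A superscript index is a residue class modulo n: i : 'I_n with 0 < i stands
   for the index i, and the ordinal 0 stands for the index n.
   [offset i m] is the t in {0, .., n-1} such that m = i + t modulo n, so that
   for d < n the cyclic range i, i+1, .., i+d is [set m | offset i m <= d]. *)
Definition offset (n : nat) (i m : 'I_n) : nat := (m + (n - i)) %% n.

Inductive base_node (n : nat) :=
  | A of 'I_n
  | L of 'I_n.

Definition base_node_code n (x : base_node n) : 'I_n + 'I_n :=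
  match x with A i => inl i | L i => inr i end.
Definition base_node_decode n (x : 'I_n + 'I_n) : base_node n :=
  match x with inl i => A i | inr i => L i end.
Lemma base_node_codeK n : cancel (@base_node_code n) (@base_node_decode n).
Proof. by case. Qed.
HB.instance Definition _ n :=
  Finite.copy (base_node n) (can_type (@base_node_codeK n)).

Definition base_edge (n l : nat) (x y : base_node n) : bool :=
  match x, y with
  | L i, A m => offset i m < l
  | _, _ => false
  end.

Definition base_network (n l : nat) : network :=
  Network (@base_edge n l) [set A i | i : 'I_n].

(* i \in {j-l+2, .., j}, for l >= 2 *)
Definition in_cut (n l : nat) (j i : 'I_n) : bool := offset i j < l.-1.

Inductive cut_node (n l : nat) (j : 'I_n) :=
  | A1 of 'I_n
  | L1 of 'I_n
  | L2 of {i : 'I_n | in_cut l j i}.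

Arguments A1 {n l j} _.
Arguments L1 {n l j} _.
Arguments L2 {n l j} _.

Definition cut_code (n l : nat) (j : 'I_n) : finType :=
  ('I_n + 'I_n + {i : 'I_n | in_cut l j i})%type.
Definition cut_node_code n l (j : 'I_n) (x : cut_node l j) : cut_code l j :=
  match x with A1 i => inl (inl i) | L1 i => inl (inr i) | L2 i => inr i end.
Definition cut_node_decode n l (j : 'I_n) (x : cut_code l j) : cut_node l j :=
  match x with inl (inl i) => A1 i | inl (inr i) => L1 i | inr i => L2 i end.
Lemma cut_node_codeK n l (j : 'I_n) :
  cancel (@cut_node_code n l j) (@cut_node_decode n l j).
Proof. by case. Qed.
HB.instance Definition _ n l (j : 'I_n) :=
  Finite.copy (cut_node l j) (can_type (@cut_node_codeK n l j)).

(* For i in the cut, the children A^[i], .., A^[i+l-1] of L^[i] are split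
   between L_1^[i], which keeps A^[i], .., A^[j], and L_2^[i], which gets
   A^[j+1], .., A^[i+l-1]. *)
Definition cut_edge (n l : nat) (j : 'I_n) (x y : cut_node l j) : bool :=
  match x, y with
  | L1 i, A1 m =>
      if in_cut l j i then offset i m <= offset i j else offset i m < l
  | L2 i, A1 m => offset (val i) j < offset (val i) m < l
  | _, _ => false
  end.

Definition cut_inflation (n l : nat) (j : 'I_n) : network :=
  Network (@cut_edge n l j) [set A1 i | i : 'I_n].

Definition drop_copy (n l : nat) (j : 'I_n) (x : cut_inflation l j) :
    base_network n l :=
  match x with
  | A1 i => A i
  | L1 i => L i
  | L2 i => L (val i)
  end.

(* Main.v *)
Require Import Defs.
From mathcomp Require Import all_boot.
From mathcomp Require Import zify.

(** Unrolling the cycle at the cut puts the visible nodes at the positions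
    0, .., n-1.  In the Cut inflation, nodes with a common latent parent are
    less than l apart, and two copies of the same latent node only occur above
    nodes more than n - l apart.  Hence, if a set of visible nodes misses a
    window of l-1 consecutive positions, its parts to the left and to the right
    of the window are injectable and have disjoint ancestral subgraphs.  It
    remains to give each of the k parts such a window, for which
    (l-1) k <= n suffices. *)

Set Implicit Arguments.
Unset Strict Implicit.
Unset Printing Implicit Defensive.

(** * Injectability along graph maps that lift parents *)

Section Fibration.
Variables (G G' : network) (drop : G' -> G).
Hypothesis drop_edge : forall x y, edge x y -> edge (drop x) (drop y).
Hypothesis lift_edge :
  forall z y, edge z (drop y) -> exists2 x, drop x = z & edge x y.

Lemma ancestral_edge (U : {set G'}) x y :
  y \in ancestral U -> edge x y -> x \in ancestral U.
Proof.
rewrite !inE => /exists_inP[u uU yu] xy; apply/exists_inP; exists u => //.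
exact: connect_trans (connect1 xy) yu.
Qed.

Lemma drop_connect x y : connect (@edge G') x y ->
  connect (@edge G) (drop x) (drop y).
Proof.
case/connectP=> p + ->; elim: p x => [|z p IHp] x //= /andP[xz zp].
exact: connect_trans (connect1 (drop_edge xz)) (IHp _ zp).
Qed.

Lemma lift_connect z y : connect (@edge G) z (drop y) ->
  exists2 x, drop x = z & connect (@edge G') x y.
Proof.
case/connectP=> p; elim: p z => [|w p IHp] z /= => [_ <-|/andP[zw wp] ey].
  by exists y.
have [x dx xy] := IHp w wp ey; rewrite -dx in zw.
have [x' dx' x'x] := lift_edge zw; exists x' => //.
exact: connect_trans (connect1 x'x) xy.
Qed.

(** Since parents lift along [drop], the ancestors of [drop @: U'] are the images of those of [U'],
    so only injectivity is left to check. *)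
Lemma injectable_fibration (U' : {set G'}) :
  (forall x, x \in visible G' -> drop x \in visible G) ->
  U' \subset visible G' -> {in ancestral U' &, injective drop} ->
  injectable drop U'.
Proof.
move=> drop_vis U'vis inj; split=> //; exists (drop @: U'); split.
- by apply/subsetP => _ /imsetP[x xU' ->]; apply/drop_vis/(subsetP U'vis).
- split=> // x y xU' yU'; apply: inj; rewrite inE; apply/exists_inP.
  + by exists x.
  + by exists y.
- split=> //; apply/setP => z; rewrite inE.
  apply/imsetP/exists_inP => [[x + ->]|[_ /imsetP[u uU' ->] /lift_connect]].
    rewrite inE => /exists_inP[u uU' xu]; exists (drop u).
      exact: imset_f.
    exact: drop_connect.
  by case=> x <- xu; exists x => //; rewrite inE; apply/exists_inP; exists u.
- move=> x y xA yA; apply/idP/idP => [|/drop_edge//].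
  (* The lifted parent [x'] is again ancestral and has the same image as [x], so injectivity
     identifies the two. *)
  case/lift_edge=> x' dx x'y.
  by rewrite -(inj _ _ (ancestral_edge yA x'y) xA dx).
Qed.

End Fibration.

(** * Positions on the unrolled cycle *)

Section Position.
Variables (n : nat) (j : 'I_n).

(* The nodes j+1, j+2, .., j of the cycle have positions 0, 1, .., n-1. *)
Definition pos (m : 'I_n) : nat := (m + (n - j.+1)) %% n.

Lemma ltn_pos m : pos m < n.
Proof. by rewrite ltn_mod; case: m => /= m; lia. Qed.

Lemma pos_surj p : p < n -> exists m, pos m = p.
Proof.
move=> pn; have n0 : 0 < n by lia.
exists (Ordinal (ltn_pmod (p + j.+1) n0)); rewrite /pos /= modnDml.
have -> : p + j.+1 + (n - j.+1) = p + n by have := ltn_ord j; lia.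
by rewrite modnDr modn_small.
Qed.

Lemma offsetE (i m : 'I_n) :
  offset i m = if i <= m then m - i else m + n - i.
Proof.
rewrite /offset; have [im jm] := (ltn_ord i, ltn_ord m).
case: leqP => h.
  have -> : m + (n - i) = (m - i) + n by lia.
  by rewrite modnDr modn_small; lia.
by rewrite modn_small; lia.
Qed.

(** The node [i] sits at position [n - 1 - offset i j]; walking on from it to [m] wraps around to
    position 0 exactly when the walk passes [j]. *)
Lemma posE (i m : 'I_n) :
  pos m + (offset i j).+1 =
    if offset i m <= offset i j then n + offset i m else offset i m.
Proof.
have -> : pos m = if j < m then m - j.+1 else m + n - j.+1.
  have [jn mn] := (ltn_ord j, ltn_ord m); rewrite /pos; case: ltnP => h.
    have -> : m + (n - j.+1) = (m - j.+1) + n by lia.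
    by rewrite modnDr modn_small; lia.
  by rewrite modn_small; lia.
have [[jn mn] iln] := (ltn_ord j, ltn_ord m, ltn_ord i).
rewrite !offsetE.
by case: (ltnP j m); case: (leqP i j); case: (leqP i m) => ? ? ?; case: leqP; lia.
Qed.

End Position.

(** * Injectable and expressible sets of the Cut inflation *)

Section CutInflation.
Variables (n l : nat) (j : 'I_n).
Hypothesis (hl : 2 <= l) (hln : l < n).
Local Notation G' := (cut_inflation l j).
Local Notation pos := (pos j).

Lemma drop_copy_edge (x y : G') :
  edge x y -> edge (drop_copy x) (drop_copy y).
Proof.
case: x y => [m|i|[i ci]] [m'|i'|i'] //=; last by case/andP.
by case: ifP => //; rewrite /in_cut; lia.
Qed.

Lemma lift_copy_edge (z : base_network n l) (y : G') :
  edge z (drop_copy y) -> exists2 x : G', drop_copy x = z & edge x y.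
Proof.
case: y => [m|i'|i']; case: z => [m'|i] //= lim.
have [ci|nci] := boolP (in_cut l j i); last first.
  by exists (L1 i) => //=; rewrite (negPf nci).
have [le|lt] := leqP (offset i m) (offset i j).
  by exists (L1 i) => //=; rewrite ci.
by exists (L2 (exist _ i ci)) => //=; rewrite lt.
Qed.

(** Every edge goes from a latent to a visible node, so directed paths have at most one edge. *)
Lemma ancestral_cutP (P : {set 'I_n}) (x : G') :
  reflect ((exists2 m, m \in P & x = A1 m) \/
           (exists2 m, m \in P & edge x (A1 m : G')))
          (x \in ancestral ([set A1 m | m in P] : {set G'})).
Proof.
rewrite inE; apply: (iffP exists_inP).
  case=> _ /imsetP[m mP ->] /connectP[[|y [|z p]] /=].
  - by left; exists m.
  - by rewrite andbT => xy e; right; exists m; rewrite //= e.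
  - by case: x y z => [?|?|?] [?|?|?] [?|?|?] //=; rewrite ?andbF.
case=> -[m mP]; first by move=> ->; exists (A1 m) => //; apply: imset_f.
by move=> xm; exists (A1 m); [apply: imset_f | apply: connect1].
Qed.

Lemma injectable_short (P : {set 'I_n}) :
  {in P &, forall m m', pos m' <= pos m + (n - l)} ->
  injectable (@drop_copy n l j) ([set A1 m | m in P] : {set G'}).
Proof.
move=> short; apply: injectable_fibration.
- exact: drop_copy_edge.
- exact: lift_copy_edge.
- by move=> _ /imsetP[m _ ->]; apply: imset_f.
- by apply/subsetP => _ /imsetP[m _ ->]; apply: imset_f.
have twice (i : 'I_n) (ci : in_cut l j i) :
    (L1 i : G') \in ancestral ([set A1 m | m in P] : {set G'}) ->
    (L2 (exist _ i ci) : G') \in ancestral ([set A1 m | m in P] : {set G'}) ->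
    False.
  case/ancestral_cutP=> -[m mP] //=; rewrite ci => le.
  case/ancestral_cutP=> -[m' m'P] //= /andP[lt ltl].
  (* Here [pos m - pos m' = n + offset i m - offset i m'], which exceeds [n - l] because
     [offset i m' < l]. *)
  have := short _ _ m'P mP; have := posE j i m; have := posE j i m'.
  by rewrite le leqNgt lt /=; lia.
move=> [m|i|[i ci]] [m'|i'|[i' ci']] //= xA yA; case=> eq.
- by rewrite eq.
- by rewrite eq.
- by subst i'; case: (twice i ci').
- by subst i'; case: (twice i ci).
- by subst i'; rewrite (bool_irrelevance ci ci').
Qed.

Lemma common_parent_pos (x : G') (m m' : 'I_n) :
  edge x (A1 m : G') -> edge x (A1 m' : G') -> pos m' < pos m + l.
Proof.
case: x => [//|i|[i ci]] /=.
  (* Outside the cut [offset i j] is at least [l - 1], so no child of [L1 i] lies past [j] and the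
     children do not wrap around. *)
  rewrite /in_cut; have := posE j i m; have := posE j i m'.
  case: (leqP (offset i m)); case: (leqP (offset i m')) => ? ?;
    case: (ltnP _ l.-1); lia.
have := posE j i m; have := posE j i m'.
case: (leqP (offset i m)); case: (leqP (offset i m')); lia.
Qed.

Lemma disjoint_ancestral_far (P Q : {set 'I_n}) :
  (forall p q, p \in P -> q \in Q -> pos p + l <= pos q) ->
  [disjoint ancestral ([set A1 m | m in P] : {set G'})
          & ancestral ([set A1 m | m in Q] : {set G'})].
Proof.
move=> far; apply/pred0P => x /=; apply/negP => /andP[].
case/ancestral_cutP=> -[p pP xp]; case/ancestral_cutP=> -[q qQ xq].
- have pq := far _ _ pP qQ; move: xq; rewrite xp => -[e].
  by rewrite e in pq; lia.
- by rewrite xp in xq.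
- by rewrite xq in xp.
- by have := common_parent_pos xp xq; have := far _ _ pP qQ; lia.
Qed.

Lemma expressible_window (P : {set 'I_n}) (a : nat) :
  a + l.-1 <= n -> {in P, forall m, (pos m < a) || (a + l.-1 <= pos m)} ->
  expressible (@drop_copy n l j) ([set A1 m | m in P] : {set G'}).
Proof.
move=> an win.
pose left := [set m in P | pos m < a]; pose right := [set m in P | ~~ (pos m < a)].
have far p q : p \in left -> q \in right -> pos p + l <= pos q.
  by rewrite !inE => /andP[_ pa] /andP[/win]; lia.
exists [set [set A1 m | m in left]; [set A1 m | m in right]]; split.
(* Positions range over [0, .., a - 1] on the left and [a + l - 1, .., n - 1] on the right; either
   way they spread over at most [n - l]. *)
- move=> _ /set2P[] ->; apply: injectable_short => m m'; rewrite !inE.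
    by move=> /andP[_ ma] /andP[_ m'a]; lia.
  by move=> /andP[/win + ma] /andP[_ m'a]; have := ltn_pos j m'; lia.
- move=> _ _ /set2P[] -> /set2P[] ->; rewrite ?eqxx // => _.
    exact: disjoint_ancestral_far.
  by rewrite disjoint_sym; apply: disjoint_ancestral_far.
rewrite /cover bigcup_setU !big_set1 -imsetU.
suff -> : left :|: right = P by [].
by apply/setP => m; rewrite !inE -andb_orr orbN andbT.
Qed.

End CutInflation.

Theorem theorem2 (n l : nat) (j : 'I_n) (k : nat)
    (hl : 2 <= l) (hln : l < n) (hk : 1 < k) (kodd : odd k)
    (hn : (l - 1) * k <= n) :
  exists V : {set {set cut_inflation l j}},
    [/\ partition V (visible (cut_inflation l j)), #|V| = k &
        forall X : {set {set cut_inflation l j}}, X \in powerset V :\ V ->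
          injectable (@drop_copy n l j) (cover X) \/
          expressible (@drop_copy n l j) (cover X)].
Proof.
rewrite subn1 in hn.
(* Blocks of [l - 1] consecutive positions; the minimum puts all positions from [(l - 1) * k] on
   into the last block. *)
pose blk (m : 'I_n) := minn (pos j m %/ l.-1) k.-1.
pose part (i : 'I_k) : {set cut_inflation l j} := [set A1 m | m : 'I_n & blk m == i].
have in_part (i : 'I_k) (m : 'I_n) : ((A1 m : cut_inflation l j) \in part i) = (blk m == i).
  by rewrite mem_imset ?inE // => ? ? [].
have part0 (i : 'I_k) : exists m, blk m = i.
  have ik := ltn_ord i.
  (* The first position of block [i] witnesses that the block is nonempty. *)
  have pn : i * l.-1 < n by nia.
  have [m mp] := pos_surj j pn; exists m.
  by rewrite /blk mp mulnK; lia.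
have part_inj : injective part.
  move=> i i' e; have [m mi] := part0 i; apply: val_inj => /=; rewrite -mi.
  by apply/eqP; rewrite -in_part -e in_part mi.
exists [set part i | i : 'I_k]; split.
- apply/and3P; split.
  + rewrite eqEsubset; apply/andP; split; apply/subsetP => x.
      by case/bigcupP=> _ /imsetP[i _ ->] /imsetP[m _ ->]; apply: imset_f.
    case/imsetP=> m _ ->; have mk : blk m < k by rewrite /blk; lia.
    by apply/bigcupP; exists (part (Ordinal mk)); [apply: imset_f | rewrite in_part].
  + apply/trivIsetP => _ _ /imsetP[i _ ->] /imsetP[i' _ ->] ne.
    apply/pred0P => x /=; apply/negP => /andP[/[dup] /imsetP[m _ ->]].
    rewrite !in_part => /eqP -> /eqP/val_inj eii'.
    by rewrite eii' eqxx in ne.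
  + apply/imsetP => -[i _ e]; have [m mi] := part0 i.
    by have := in_part i m; rewrite -e inE mi eqxx.
- by rewrite card_imset // card_ord.
move=> X; rewrite !inE => /andP[neX sX]; right.
have [i iX] : exists i, part i \notin X.
  apply/existsP; apply: contraNT neX; rewrite negb_exists => /forallP allX.
  rewrite eqEsubset sX; apply/subsetP => _ /imsetP[i _ ->].
  by have := allX i; rewrite negbK.
have -> : cover X = [set A1 m | m in [set m | (A1 m : cut_inflation l j) \in cover X]].
  apply/setP => x; apply/idP/imsetP => [xX|[m + ->]]; last by rewrite inE.
  case/bigcupP: (xX) => B /(subsetP sX) /imsetP[i' _ ->] /imsetP[m _ e].
  by exists m; rewrite // inE -e.
have ik := ltn_ord i.
(* The window is the first [l - 1] positions of the missing block [i]; it fits because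
   [i + 1 <= k]. *)
apply: (@expressible_window n l j hl hln _ (i * l.-1)).
  by apply: leq_trans hn; rewrite -mulSnr mulnC leq_mul2l ik orbT.
move=> m; rewrite inE => /bigcupP[B BX].
have /imsetP[i' _ eB] := subsetP sX _ BX; rewrite eB in_part => /eqP mi'.
have : blk m != i.
  apply: contraNneq iX => mi; suff -> : i = i' by rewrite -eB.
  by apply: val_inj; rewrite /= -mi -mi'.
(* A position inside the window would have quotient [i] and so put [m] in block [i]. *)
apply: contraR; rewrite negb_or -leqNgt -ltnNge => /andP[lo hi].
have mi : pos j m %/ l.-1 = i.
  by rewrite -(subnKC lo) divnMDl ?divn_small ?addn0 ?ltn_subLR //; lia.
by rewrite /blk mi; lia.
Qed.
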